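(* Let $X$ be a topological space, $Y$ a topological vector space, and let $F,G:X\to 2^Y$ be multifunctions which are V-lsc at $x_0\in X$. Then the vector sum $F+G$, defined by $(F+G)(x)=\{a+b:a\in F(x),\ b\in G(x)\}$ for $x\in X$, is V-lsc at $x_0$.
   Context: $2^Y$ is the family of all subsets of $Y$ (including $\emptyset$); a multifunction from $X$ to $Y$ is a map $F:X\to 2^Y$. $F$ is V-lsc at $x_0$ if for every open $G\subset Y$ with $F(x_0)\cap G\neq\emptyset$ there is a neighbourhood $U(x_0)$ of $x_0$ such that $F(x)\cap G\neq\emptyset$ for every $x\in U(x_0)$. *)

(* Defs.v *)
From HB Require Import structures.
From mathcomp Require Import all_boot all_order all_algebra.
From mathcomp Require Import all_classical all_reals all_analysis.
Import GRing.Theory.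
Import numFieldNormedType.Exports.
Set Implicit Arguments.
Unset Strict Implicit.
Unset Printing Implicit Defensive.
Local Open Scope classical_set_scope.
Local Open Scope ring_scope.

(* A multifunction from X to Y is a map X -> set Y; empty values are allowed. *)
Definition V_lsc_at (X Y : topologicalType) (F : X -> set Y) (x0 : X) : Prop :=
  forall G : set Y, open G -> F x0 `&` G !=set0 ->
    exists2 U : set X, nbhs x0 U & forall x, U x -> F x `&` G !=set0.

Definition vector_sum (X : Type) (Y : zmodType) (F G : X -> set Y) : X -> set Y :=
  fun x => [set a + b | a in F x & b in G x].

(* Main.v *)
Require Import Defs.
From HB Require Import structures.
From mathcomp Require Import all_boot all_order all_algebra.
From mathcomp Require Import all_classical all_reals all_analysis.
Import GRing.Theory.
Import numFieldNormedType.Exports.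
Set Implicit Arguments.
Unset Strict Implicit.
Unset Printing Implicit Defensive.
Local Open Scope classical_set_scope.
Local Open Scope ring_scope.

(* [topologicalLmodType K] is a topological vector space over K, with jointly
   continuous addition and scaling, neither Hausdorff nor locally convex by
   assumption ([tvsType] would add local convexity); a numFieldType K covers
   both the real and the complex scalars. *)
Theorem theorem5p1 (K : numFieldType) (X : topologicalType)
    (Y : topologicalLmodType K) (F G : X -> set Y) (x0 : X) :
  V_lsc_at F x0 -> V_lsc_at G x0 -> V_lsc_at (vector_sum F G) x0.
Proof.
move=> Flsc Glsc W oW [_ [[a Fa [b Gb <-]] Wab]].
(* Joint continuity of addition at [(a, b)] yields a box [A] × [B] around this point whose sums all
   lie in [W]. *)
have := @add_continuous Y (a, b) W (open_nbhs_nbhs (conj oW Wab)).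
case=> -[A B] /= [nA nB] AB.
(* Lower semicontinuity tests open sets only, hence [A°] in place of [A]; it contains [a] because
   [A] is a neighbourhood of [a]. *)
have [U nU UF] : exists2 U, nbhs x0 U & forall x, U x -> F x `&` A° !=set0.
  by apply: Flsc; [exact: open_interior | exists a].
have [V nV VG] : exists2 V, nbhs x0 V & forall x, V x -> G x `&` B° !=set0.
  by apply: Glsc; [exact: open_interior | exists b].
exists (U `&` V); first exact: filterI.
(* The points [c] and [d] depend on [x], but the box was fixed beforehand, so [c + d] stays in
   [W]. *)
move=> x [/UF[c [Fc /interior_subset Ac]] /VG[d [Gd /interior_subset Bd]]].
exists (c + d); split; first by exists c => //; exists d.
exact: (AB (c, d)).
Qed.
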